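(* Let $T$ be a completely non-unitary contraction on a Hilbert space $H$, let $V:\mathfrak D_T\to\mathfrak D$ and $V_*:\mathfrak D_{T^*}\to\mathfrak D_*$ be unitary operators (coordinate operators), let $\theta=\theta_{T,V,V_*}$ be the corresponding characteristic function, and let $\mathcal M_\theta$ on $\mathcal K_\theta$ be the corresponding model operator in any transcription, with transcription operator $\Psi^*:\mathcal X\to\widetilde{\mathcal K}$. Put $\widetilde{\mathbf e}=\Psi^*\mathbf e$ and $\widetilde{\mathbf e}_*=\Psi^*\mathbf e_*$. Then the operators $\mathbf C_*:\mathfrak D_*\to\mathfrak D_{\mathcal M_\theta^*}$ and $\mathbf C:\mathfrak D\to\mathfrak D_{\mathcal M_\theta}$ given by $$\mathbf C_*e_*=\bigl(D_{\mathcal M_\theta^*}|_{\mathfrak D_{\mathcal M_\theta^*}}\bigr)^{-1}P_{\mathcal K_\theta}M_z\,\widetilde{\mathbf e}_*(e_* ),\quad e_*\in\mathfrak D_*,$$ $$\mathbf Ce=\bigl(D_{\mathcal M_\theta}|_{\mathfrak D_{\mathcal M_\theta}}\bigr)^{-1}P_{\mathcal K_\theta}M_{\bar z}\,\widetilde{\mathbf e}(e),\quad e\in\mathfrak D,$$ are (well-defined) unitary operators that agree with the coordinate operators $V$ and $V_*$; that is, there is a unitary operator $\Phi:\mathcal K_\theta\to H$ with $T\Phi=\Phi\mathcal M_\theta$ and $$\mathbf C^*=V\Phi|_{\mathfrak D_{\mathcal M_\theta}},\qquad \mathbf C_*^*=V_*\Phi|_{\mathfrak D_{\mathcal M_\theta^*}}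 .$$
   Context: For a contraction $A$: $D_A=(\mathbf I-A^*A)^{1/2}$, $\mathfrak D_A=\operatorname{clos}\operatorname{Ran}D_A$. A contraction is completely non-unitary if it has no non-zero reducing subspace on which it acts as a unitary operator. $\mathfrak D,\mathfrak D_*$ are Hilbert spaces with $\dim\mathfrak D=\dim\mathfrak D_T$, $\dim\mathfrak D_*=\dim\mathfrak D_{T^*}$. Characteristic function: $\theta_{T,V,V_*}(z)=V_*\bigl(-T+zD_{T^*}(\mathbf I-zT^* )^{-1}D_T\bigr)V^*|_{\mathfrak D}$, $z\in\mathbb D$. Dilation: let $G=\ell^2(\mathbb Z_+;\mathfrak D)$ and $G_*=\ell^2(\mathbb Z_+;\mathfrak D_* )$, let $\mathcal E$ and $\mathcal E_*$ be the forward shifts $(x_0,x_1,\dots)\mapsto(0,x_0,x_1,\dots)$ on $G$ and $G_*$, and let $\mathbf e:\mathfrak D\to G$, $\mathbf e_*:\mathfrak D_*\to G_*$ be the embeddings $x\mapsto(x,0,0,\dots)$. On $\mathcal X=G_*\oplus H\oplus G$ the operator $$\mathcal U=\begin{pmatrix}\mathcal E_*^*&0&0\\ D_{T^*}V_*^*\mathbf e_*^*&T&0\\ -\mathbf eVT^*V_*^*\mathbf e_*^*&\mathbf eVD_T&\mathcal E\end{pmatrix}$$ is a minimal unitary dilation of $T$ (here $V,V_*$ are extended by $0$ to the orthogonal complements of the defect spaces). Transcription of the model: a unitary operator $\Psi^*$ from $\mathcal X$ onto a Hilbert space $\widetilde{\mathcal K}$ of ($\mathfrak D_*\oplus\mathfrak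 D$)-valued functions on the circle (a closed subspace of $L^2(\mathfrak D_*\oplus\mathfrak D)$ or of a weighted version $L^2(W;\mathfrak D_*\oplus\mathfrak D)$ with operator weight $W$) such that $\Psi^*\mathcal U=M_z\Psi^*$, where $M_z$ is multiplication by $z$. The model space is $\mathcal K_\theta=\Psi^*(H)$, the model operator is $\mathcal M_\theta=P_{\mathcal K_\theta}M_z|_{\mathcal K_\theta}$, and $P_{\mathcal K_\theta}$ is the orthogonal projection of $\widetilde{\mathcal K}$ onto $\mathcal K_\theta$. The inverses $(D_{A}|_{\mathfrak D_{A}})^{-1}$ are understood as defined on $\operatorname{Ran}D_A$. *)

(* Defs.v *)
From HB Require Import structures.
From mathcomp Require Import all_boot all_order all_algebra.
From mathcomp Require Import complex ring lra.
From mathcomp Require Import all_classical all_reals all_analysis.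

Set Implicit Arguments.
Unset Strict Implicit.
Unset Printing Implicit Defensive.

Import Order.TTheory GRing.Theory Num.Theory numFieldNormedType.Exports.

Local Open Scope classical_set_scope.
Local Open Scope ring_scope.

HB.mixin Record isInnerProduct (R : realType) V & NormedModule R[i] V := {
  dot : V -> V -> R[i];
  dotPl : forall (a : R[i]) (x y z : V),
    dot (a *: x + y) z = a * dot x z + dot y z;
  dotC : forall x y : V, dot x y = (dot y x)^*;
  normr_dot : forall x : V, `|x| ^+ 2 = dot x x }.

#[short(type="innerProductType")]
HB.structure Definition InnerProduct (R : realType) :=
  {V of NormedModule R[i] V & isInnerProduct R V}.

#[short(type="hilbertType")]
HB.structure Definition Hilbert (R : realType) :=
  {V of CompleteNormedModule R[i] V & isInnerProduct R V}.

HB.factory Record Lmodule_isInnerProduct (R : realType) V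
    & GRing.Lmodule R[i] V := {
  dot : V -> V -> R[i];
  dotPl : forall (a : R[i]) (x y z : V),
    dot (a *: x + y) z = a * dot x z + dot y z;
  dotC : forall x y : V, dot x y = (dot y x)^*;
  dot_ge0 : forall x : V, 0 <= dot x x;
  dot_eq0 : forall x : V, dot x x = 0 -> x = 0 }.

HB.builders Context (R : realType) V & Lmodule_isInnerProduct R V.

Let nrm (x : V) : R[i] := sqrtC (dot x x).

Let dotDl x y z : dot (x + y) z = dot x z + dot y z.
Proof. by rewrite -[x]scale1r dotPl mul1r scale1r. Qed.

Let dot0l z : dot 0 z = 0.
Proof. by apply: (addrI (dot 0 z)); rewrite -dotDl !addr0. Qed.

Let dotZl a x z : dot (a *: x) z = a * dot x z.
Proof. by rewrite -[a *: x]addr0 dotPl dot0l addr0. Qed.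

Let dotDr x y z : dot x (y + z) = dot x y + dot x z.
Proof. by rewrite (dotC x y) (dotC x z) dotC dotDl rmorphD. Qed.

Let dotZr a x z : dot x (a *: z) = a^* * dot x z.
Proof. by rewrite (dotC x z) dotC dotZl rmorphM. Qed.

Let dot_real x : dot x x \is Num.real.
Proof. exact: ger0_real (dot_ge0 x). Qed.

Let CS x y : `|dot x y| ^+ 2 <= dot x x * dot y y.
Proof.
have [y0|y0] := eqVneq (dot y y) 0.
  by rewrite (dot_eq0 y0) dotC dot0l conjC0 normr0 expr0n mulr_ge0// dot_ge0.
have yy : 0 < dot y y by rewrite lt_def y0 dot_ge0.
have := dot_ge0 (dot y y *: x + (- dot x y) *: y).
rewrite dotDl !dotDr !dotZl !dotZr rmorphN /= (conj_Creal (dot_real y)).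
rewrite (dotC y x) normCK.
set a := dot x x; set b := dot y y; set c := dot x y => H.
rewrite -(ler_pM2l yy) -/b -subr_ge0; apply: le_trans H _.
rewrite le_eqVlt; apply/orP; left; apply/eqP.
ring.
Qed.

Let nrmD x y : nrm (x + y) <= nrm x + nrm y.
Proof.
rewrite /nrm -ler_sqr ?nnegrE ?addr_ge0 ?sqrtC_ge0 ?dot_ge0//.
rewrite sqrrD !sqrtCK dotDl !dotDr (dotC y x).
have -> : dot x x + dot x y + ((dot x y)^* + dot y y) =
  dot x x + (dot x y + (dot x y)^*) + dot y y by ring.
rewrite lerD2r lerD2l -sqrtCM ?nnegrE ?dot_ge0//.
rewrite -[X in _ <= X]mulr_natr -ler_pdivrMr ?ltr0n// -ReE.
apply: le_trans (leif_Re_Creal _) _.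
by rewrite -ler_sqr ?nnegrE ?sqrtC_ge0 ?mulr_ge0 ?dot_ge0// sqrtCK CS.
Qed.

Let nrmZ (l : R[i]) x : nrm (l *: x) = `|l| * nrm x.
Proof.
rewrite /nrm dotZl dotZr mulrA -normCK sqrtCM ?nnegrE ?exprn_ge0 ?dot_ge0//.
by rewrite sqrCK.
Qed.

Let nrm_eq0 x : nrm x = 0 -> x = 0.
Proof. by move/eqP; rewrite sqrtC_eq0 => /eqP/dot_eq0. Qed.

HB.instance Definition _ := Lmodule_isNormed.Build R[i] V nrmD nrmZ nrm_eq0.

Let nrm_dot (x : V) : `|x| ^+ 2 = dot x x.
Proof. by rewrite /Num.norm /= /nrm sqrtCK. Qed.

HB.instance Definition _ := isInnerProduct.Build R V dotPl dotC nrm_dot.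

HB.end.

Section InnerProductTheory.
Variables (R : realType) (V : innerProductType R).
Implicit Types x y z : V.

Lemma dotDl x y z : dot (x + y) z = dot x z + dot y z.
Proof. by rewrite -[x]scale1r dotPl mul1r scale1r. Qed.

Lemma dot0l z : dot 0 z = 0.
Proof. by apply: (addrI (dot 0 z)); rewrite -dotDl !addr0. Qed.

Lemma dotZl (a : R[i]) x z : dot (a *: x) z = a * dot x z.
Proof. by rewrite -[a *: x]addr0 dotPl dot0l addr0. Qed.

Lemma dot0r z : dot z 0 = 0.
Proof. by rewrite dotC dot0l conjC0. Qed.

Lemma dot_ge0 x : 0 <= dot x x.
Proof. by rewrite -normr_dot exprn_ge0. Qed.

Lemma dot_eq0 x : dot x x = 0 -> x = 0.
Proof. by rewrite -normr_dot => /eqP; rewrite sqrf_eq0 normr_eq0 => /eqP. Qed.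

Lemma dot_re x : complex.Re (dot x x) \is Num.nneg.
Proof. by have := dot_ge0 x; case: (dot x x) => a b /andP[]. Qed.

Lemma dot_im x : complex.Im (dot x x) = 0.
Proof. by have := dot_ge0 x; case: (dot x x) => a b /andP[/eqP]. Qed.

End InnerProductTheory.

(* The Hilbert space direct sum; the product type itself carries the sup norm. *)
Definition hsum (R : realType) (A B : innerProductType R) : Type :=
  (A * B)%type.

Section DirectSum.
Variables (R : realType) (A B : innerProductType R).

HB.instance Definition _ := GRing.Lmodule.copy (hsum A B) (A * B)%type.

Definition hsum_dot (x y : hsum A B) : R[i] := dot x.1 y.1 + dot x.2 y.2.

Let hdotP a x y z :
  hsum_dot (a *: x + y) z = a * hsum_dot x z + hsum_dot y z.
Proof. by rewrite /hsum_dot !dotPl mulrDr addrACA. Qed.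

Let hdotC x y : hsum_dot x y = (hsum_dot y x)^*.
Proof.
by rewrite /hsum_dot rmorphD/= -(dotC x.1 y.1) -(dotC x.2 y.2).
Qed.

Let hdot_ge0 x : 0 <= hsum_dot x x.
Proof. by rewrite addr_ge0 ?dot_ge0. Qed.

Let hdot_eq0 x : hsum_dot x x = 0 -> x = 0.
Proof.
move/eqP; rewrite paddr_eq0 ?dot_ge0// => /andP[/eqP/dot_eq0 x1 /eqP/dot_eq0 x2].
by rewrite [x]surjective_pairing x1 x2.
Qed.

HB.instance Definition _ :=
  Lmodule_isInnerProduct.Build R (hsum A B) hdotP hdotC hdot_ge0 hdot_eq0.

Lemma hsum_dotE (x y : hsum A B) : dot x y = dot x.1 y.1 + dot x.2 y.2.
Proof. by []. Qed.

End DirectSum.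

Section SquareSummable.
Variables (R : realType) (D : innerProductType R).

Let dot_bound (x y : D) (p := complex.Re (dot x x)) (q := complex.Re (dot y y)) :
  `|complex.Re (dot x y)| <= p + q /\ `|complex.Im (dot x y)| <= p + q.
Proof.
have key c : 0 <= dot x x + c^* * dot x y + c * (dot x y)^* + c * c^* * dot y y.
  have := dot_ge0 (x + c *: y).
  rewrite dotDl dotZl (dotC x (_ + _)) (dotC y (_ + _)) !dotDl !dotZl.
  rewrite !rmorphD !rmorphM/= -!(dotC x x) -!(dotC y y) (dotC y x).
  by rewrite conjCK mulrDr !addrA mulrA.
have := dot_im x; have := dot_im y; have := dot_re x; have := dot_re y.
have := key 1; have := key (-1); have := key (0 +i* 1)%C.
have := key (0 +i* (-1))%C.
rewrite /p /q.
case: (dot x x) (dot y y) (dot x y) => [a1 b1] [a2 b2] [a3 b3].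
move=> /andP[_ /= h1] /andP[_ /= h2] /andP[_ /= h3] /andP[_ /= h4] /=.
rewrite !nnegrE => g1 g2 e1 e2; rewrite !ler_norml; split; apply/andP; split; lra.
Qed.

Definition square_summable : {pred nat -> D} :=
  [pred x | `[< cvgn [series complex.Re (dot (x n) (x n))]_n >]].

Let dom_cvg (u v : R^nat) :
  (forall n, `|u n| <= v n) -> cvgn (series v) -> cvgn (series u).
Proof.
move=> uv cv; apply: normed_cvg; apply: (series_le_cvg _ _ uv cv) => n //.
exact: le_trans (uv n).
Qed.

Let sq (x : nat -> D) : R^nat := fun n => complex.Re (dot (x n) (x n)).

Let sq_ge0 x n : 0 <= sq x n.
Proof. by have := dot_re (x n); rewrite nnegrE. Qed.

Let cvg_pair (x y : nat -> D) : x \in square_summable ->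
  y \in square_summable -> cvgn (series (sq x + sq y)).
Proof.
by move=> /asboolP cx /asboolP cy; apply: is_cvg_seriesD.
Qed.

Let cvg_re (x y : nat -> D) : x \in square_summable ->
  y \in square_summable -> cvgn (series (fun n => complex.Re (dot (x n) (y n)))).
Proof.
move=> sx sy; apply: dom_cvg (cvg_pair sx sy) => n.
exact: (dot_bound (x n) (y n)).1.
Qed.

Let cvg_im (x y : nat -> D) : x \in square_summable ->
  y \in square_summable -> cvgn (series (fun n => complex.Im (dot (x n) (y n)))).
Proof.
move=> sx sy; apply: dom_cvg (cvg_pair sx sy) => n.
exact: (dot_bound (x n) (y n)).2.
Qed.

Lemma square_summable_submod : submod_closed square_summable.
Proof.
split=> [|a x y sx sy].
  apply/asboolP; rewrite (_ : series _ = fun=> 0); first exact: is_cvg_cst.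
  by apply/funext => n; rewrite /series/= big1// => i _; rewrite dot0l.
apply/asboolP.
have -> : series (fun n => complex.Re (dot ((a *: x + y) n) ((a *: x + y) n))) =
  series ((complex.Re (a * a^*) *: sq x + sq y) +
  ((2 * complex.Re a) *: (fun n => complex.Re (dot (x n) (y n))) -
  (2 * complex.Im a) *: (fun n => complex.Im (dot (x n) (y n))))).
  congr series; apply/funext => n.
  rewrite /sq !fctE/= dotPl (dotC (x n) (_ + _)) (dotC (y n) (_ + _)) !dotPl.
  rewrite !rmorphD !rmorphM/= -!(dotC (x n) (x n)) -!(dotC (y n) (y n)).
  rewrite (dotC (y n) (x n)) conjCK.
  have := dot_im (x n); have := dot_im (y n).
  case: (a) (dot (x n) (x n)) (dot (y n) (y n)) (dot (x n) (y n)).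
  move=> a1 a2 [p1 p2] [q1 q2] [c1 c2] /= q20 p20.
  by rewrite /GRing.scale/= ?q20 ?p20; ring.
apply: is_cvg_seriesD; apply: is_cvg_seriesD.
- by apply: is_cvg_seriesZ; apply/asboolP.
- by apply/asboolP.
- by apply: is_cvg_seriesZ; exact: cvg_re.
- by rewrite is_cvg_seriesN; apply: is_cvg_seriesZ; exact: cvg_im.
Qed.

HB.instance Definition _ :=
  GRing.isSubmodClosed.Build R[i] (nat -> D) square_summable
    square_summable_submod.

Record l2 : Type := L2 {l2seq :> nat -> D; _ : l2seq \in square_summable}.

HB.instance Definition _ := [isSub for l2seq].
HB.instance Definition _ := [Choice of l2 by <:].
HB.instance Definition _ := [SubChoice_isSubLmodule of l2 by <:].

Definition l2_dot (x y : l2) : R[i] :=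
  (limn [series complex.Re (dot (x n) (y n))]_n
     +i* limn [series complex.Im (dot (x n) (y n))]_n)%C.

Let l2seqD (a : R[i]) (x y : l2) n : (a *: x + y) n = a *: x n + y n.
Proof. by []. Qed.

Let mem_l2 (x : l2) : (x : nat -> D) \in square_summable.
Proof. by case: x. Qed.

Let l2_dotP a (x y z : l2) : l2_dot (a *: x + y) z = a * l2_dot x z + l2_dot y z.
Proof.
have cr (u v : l2) := cvg_re (mem_l2 u) (mem_l2 v).
have ci (u v : l2) := cvg_im (mem_l2 u) (mem_l2 v).
case: a => a1 a2; rewrite /l2_dot.
have -> : series (fun n => complex.Re (dot (((a1 +i* a2)%C *: x + y) n) (z n))) =
    series (a1 *: (fun n => complex.Re (dot (x n) (z n))) -
      a2 *: (fun n => complex.Im (dot (x n) (z n))) +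
      (fun n => complex.Re (dot (y n) (z n)))).
  congr series; apply/funext => n; rewrite l2seqD dotPl !fctE.
  by case: (dot (x n) _) (dot (y n) _) => [? ?] [? ?].
have -> : series (fun n => complex.Im (dot (((a1 +i* a2)%C *: x + y) n) (z n))) =
    series (a1 *: (fun n => complex.Im (dot (x n) (z n))) +
      a2 *: (fun n => complex.Re (dot (x n) (z n))) +
      (fun n => complex.Im (dot (y n) (z n)))).
  congr series; apply/funext => n; rewrite l2seqD dotPl !fctE.
  by case: (dot (x n) _) (dot (y n) _) => [? ?] [? ?].
have cZ (b : R) (u : R^nat) (cu : cvgn (series u)) := @is_cvg_seriesZ R u b cu.
rewrite lim_seriesD; [|apply: is_cvg_seriesB; exact: cZ|exact: cr].
rewrite lim_seriesB; [|exact: cZ|exact: cZ].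
rewrite lim_seriesD; [|apply: is_cvg_seriesD; exact: cZ|exact: ci].
rewrite (@lim_seriesD _ (a1 *: _)); [|exact: cZ|exact: cZ].
by rewrite !lim_seriesZ.
Qed.

Let l2_dotC (x y : l2) : l2_dot x y = (l2_dot y x)^*.
Proof.
rewrite /l2_dot.
have -> : series (fun n => complex.Re (dot (x n) (y n))) =
    series (fun n => complex.Re (dot (y n) (x n))).
  congr series; apply/funext => n; rewrite dotC.
  by case: (dot (y n) _).
have -> : series (fun n => complex.Im (dot (x n) (y n))) =
    series (- (fun n => complex.Im (dot (y n) (x n)))).
  congr series; apply/funext => n; rewrite dotC !fctE.
  by case: (dot (y n) _).
by rewrite lim_seriesN //; exact: (cvg_im (mem_l2 _) (mem_l2 _)).
Qed.

Let l2_dot_im (x : l2) :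
  series (fun n => complex.Im (dot (x n) (x n))) = (fun=> 0) :> R^nat.
Proof.
by apply/funext => n; rewrite /series/= big1// => i _; rewrite dot_im.
Qed.

Let l2_dot_ge0 (x : l2) : 0 <= l2_dot x x.
Proof.
rewrite /l2_dot l2_dot_im lim_cst//; apply/andP; split=> //=.
apply: limr_ge; first exact: (cvg_re (mem_l2 _) (mem_l2 _)).
by apply: nearW => n; apply: sumr_ge0 => i _; exact: sq_ge0.
Qed.

Let l2_dot_eq0 (x : l2) : l2_dot x x = 0 -> x = 0.
Proof.
case=> l0 _; apply/val_inj/funext => n /=; apply: dot_eq0.
have cx := cvg_re (mem_l2 x) (mem_l2 x).
have nd : nondecreasing_seq (series (sq x)).
  by apply: nondecreasing_series => k _ _; exact: sq_ge0.
have s0 k : series (sq x) k = 0.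
  apply/eqP; rewrite eq_le; apply/andP; split.
    by rewrite -l0; exact: nondecreasing_cvgn_le.
  by apply: sumr_ge0 => i _; exact: sq_ge0.
have := s0 n.+1; rewrite seriesSr s0 add0r /sq => r0.
have := dot_im (x n); move: r0; case: (dot (x n) (x n)) => a b /= -> ->.
by [].
Qed.

HB.instance Definition _ := Lmodule_isInnerProduct.Build R l2
  l2_dotP l2_dotC l2_dot_ge0 l2_dot_eq0.

Lemma l2_dotE (x y : l2) : dot x y = l2_dot x y.
Proof. by []. Qed.

Lemma l2_cvg_re (x y : l2) :
  cvgn (series (fun n => complex.Re (dot (x n) (y n)))).
Proof. exact: cvg_re (mem_l2 x) (mem_l2 y). Qed.

Lemma l2_cvg_im (x y : l2) :
  cvgn (series (fun n => complex.Im (dot (x n) (y n)))).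
Proof. exact: cvg_im (mem_l2 x) (mem_l2 y). Qed.

End SquareSummable.

Section Shift.
Variables (R : realType) (D : innerProductType R).
Implicit Types x y : l2 D.

Let series_tail (u : R^nat) : (fun n => series u n.+1) =
  (fun n => u 0%N + series (fun k => u k.+1) n).
Proof. by apply/funext => n; rewrite /series/= big_nat_recl. Qed.

Let series_tailP (u : R^nat) (l : R) :
  series u @ \oo --> u 0%N + l <-> series (fun k => u k.+1) @ \oo --> l.
Proof.
rewrite -(cvg_shiftS (series u)) series_tail; split=> h; last first.
  by apply: cvgD => //; exact: cvg_cst.
have c : (fun=> u 0%N) @ \oo --> u 0%N by exact: cvg_cst.
suff <- : (fun n => u 0%N + series (fun k => u k.+1) n) - (fun=> u 0%N) =
    series (fun k => u k.+1).
  by rewrite -[l](addrK (u 0%N)) [l + _]addrC; exact: cvgB.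
by apply/funext => n; rewrite !fctE addrC addrA addNr add0r.
Qed.

Let series_tail_is_cvg (u : R^nat) :
  cvgn (series u) <-> cvgn (series (fun k => u k.+1)).
Proof.
split=> [/cvg_ex[l ul]|/cvg_ex[l ul]]; apply/cvg_ex.
  by exists (l - u 0%N); apply/series_tailP; rewrite subrKC.
by exists (u 0%N + l); apply/series_tailP.
Qed.

Let l2_cvg x : cvgn (series (fun n => complex.Re (dot (x n) (x n)))).
Proof. by case: x => x /= /asboolP. Qed.

Let shift_subproof x :
  (fun n => if n is k.+1 then x k else 0) \in @square_summable R D.
Proof. by apply/asboolP/series_tail_is_cvg; exact: l2_cvg. Qed.

Let bshift_subproof x : (fun n => x n.+1) \in @square_summable R D.
Proof.
apply/asboolP.
apply: (proj1 (series_tail_is_cvg (fun n => complex.Re (dot (x n) (x n))))).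
exact: l2_cvg.
Qed.

Let embed_subproof (d : D) :
  (fun n => if n is _.+1 then 0 else d) \in @square_summable R D.
Proof.
apply/asboolP/series_tail_is_cvg.
rewrite (_ : series _ = fun=> 0); first exact: is_cvg_cst.
by apply/funext => n; rewrite /series/= big1// => i _; rewrite dot0l.
Qed.

Definition l2_shift x : l2 D := L2 (shift_subproof x).
Definition l2_bshift x : l2 D := L2 (bshift_subproof x).
Definition l2_embed (d : D) : l2 D := L2 (embed_subproof d).
Definition l2_coef0 x : D := x 0%N.

Lemma l2_bshift_adjoint x y : dot (l2_shift x) y = dot x (l2_bshift y).
Proof.
rewrite !l2_dotE; congr (_ +i* _)%C; apply: cvg_lim => //.
  set u := fun n => complex.Re (dot (l2_shift x n) (y n)).
  rewrite -[limn _]add0r -[X in X + _](_ : u 0%N = 0); last first.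
    by rewrite /u /= dot0l.
  by apply/series_tailP; exact: l2_cvg_re x (l2_bshift y).
set u := fun n => complex.Im (dot (l2_shift x n) (y n)).
rewrite -[limn _]add0r -[X in X + _](_ : u 0%N = 0); last first.
  by rewrite /u /= dot0l.
by apply/series_tailP; exact: l2_cvg_im x (l2_bshift y).
Qed.

Lemma l2_coef0_adjoint (d : D) x : dot (l2_embed d) x = dot d (l2_coef0 x).
Proof.
have z (f : R[i] -> R) : f 0 = 0 ->
    series (fun n => f (dot (l2_embed d n.+1) (x n.+1))) @ \oo --> (0 : R).
  move=> f0; rewrite (_ : series _ = fun=> 0); first exact: cvg_cst.
  by apply/funext => n; rewrite /series/= big1// => i _; rewrite dot0l.
rewrite l2_dotE; case E: (dot d _) => [a b]; congr (_ +i* _)%C; apply: cvg_lim => //.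
  rewrite -[a]/(complex.Re (a +i* b)%C) -E -[X in _ --> X]addr0.
  by apply/(series_tailP (fun n => complex.Re (dot (l2_embed d n) (x n)))); exact: z.
rewrite -[b]/(complex.Im (a +i* b)%C) -E -[X in _ --> X]addr0.
by apply/(series_tailP (fun n => complex.Im (dot (l2_embed d n) (x n)))); exact: z.
Qed.

End Shift.

(* Operators on (closed) subspaces: a subspace is a set [S] of an ambient space
   and an operator on it is a function on the ambient space of which only the
   values on [S] matter; an operator on the whole space is the case [S = setT]. *)
Section Operators.
Variables (R : realType).

Definition linear_on (A B : lmodType R[i]) (S : set A) (f : A -> B) : Prop :=
  forall (a : R[i]) (x y : A), S x -> S y -> f (a *: x + y) = a *: f x + f y.

Definition subspace_set (A : lmodType R[i]) (S : set A) : Prop :=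
  S 0 /\ forall (a : R[i]) (x y : A), S x -> S y -> S (a *: x + y).

Section OneSpace.
Variable A : innerProductType R.
Implicit Types (S : set A) (T Ts D P : A -> A).

Definition closed_subspace S : Prop := closed S /\ subspace_set S.

Definition orthogonal_to S (x : A) : Prop := forall y, S y -> dot x y = 0.

(* Set to 0 at points that have no orthogonal projection on [S]. *)
Definition orthoproj S (x : A) : A :=
  xget 0 [set p | S p /\ orthogonal_to S (x - p)].

Definition contraction_op T : Prop := forall x, `|T x| <= `|x|.

End OneSpace.

Section TwoSpaces.
Variables A B : innerProductType R.

Definition adjoint_on (S : set A) (S' : set B) (f : A -> B) (g : B -> A) :
    Prop :=
  [/\ forall x, S x -> S' (f x), forall y, S' y -> S (g y) &
      forall x y, S x -> S' y -> dot (f x) y = dot x (g y)].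

Definition unitary_on (S : set A) (S' : set B) (f : A -> B) : Prop :=
  [/\ linear_on S f, f @` S = S' &
      forall x y, S x -> S y -> dot (f x) (f y) = dot x y].

End TwoSpaces.

Section Defect.
Variable A : innerProductType R.
Implicit Types (S : set A) (T Ts D P : A -> A).

(* [D] is the nonnegative square root of the operator [P] on [S]. *)
Definition sqrt_on S P D : Prop :=
  [/\ linear_on S D, adjoint_on S S D D,
      forall x, S x -> 0 <= dot (D x) x &
      forall x, S x -> D (D x) = P x].

(* [D] is D_T = (I - T^* T)^(1/2), where [Ts] is T^*. *)
Definition defect_on S T Ts D : Prop := sqrt_on S (fun x => x - Ts (T x)) D.

Definition defect_space S D : set A := closure (D @` S).

(* [Ts] is T^*. *)
Definition completely_nonunitary T Ts : Prop :=
  forall S, closed_subspace S ->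
    (forall x, S x -> S (T x)) -> (forall x, S x -> S (Ts x)) ->
    unitary_on S S T -> S = [set 0].

End Defect.

(* [V], unitary from the closed subspace [S] onto [D], is extended by 0 to the
   orthogonal complement of [S]; [Va] is the adjoint of the extension. *)
Record coordinate_operator (H D : innerProductType R) (S : set H) (V : H -> D)
    (Va : D -> H) : Prop := CoordinateOperator {
  coord_linear : linear_on setT V;
  coord_unitary : unitary_on S setT V;
  coord_orth : forall x, orthogonal_to S x -> V x = 0;
  coord_adjoint : adjoint_on setT setT V Va }.

End Operators.

(* the space G_* (+) H (+) G of the dilation *)
Notation dilation_space H D Ds := (hsum (hsum (l2 Ds) H) (l2 D)).

Section Dilation.
Variables (R : realType) (H D Ds : innerProductType R).
Variables (T Ts DT DTs : H -> H).
Variables (V : H -> D) (Va : D -> H) (Vs : H -> Ds) (Vsa : Ds -> H).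

(* [h] is the vector (I - z Ts)^(-1) DT (Va d). *)
Definition characteristic_function (theta : R[i] -> D -> Ds) : Prop :=
  forall z : R[i], `|z| < 1 -> forall (d : D) (h : H),
    h - z *: Ts h = DT (Va d) -> theta z d = Vs (- T (Va d) + z *: DTs h).

Definition in_Gs (g : l2 Ds) : dilation_space H D Ds := ((g, 0), 0).
Definition in_H (h : H) : dilation_space H D Ds := ((0, h), 0).
Definition in_G (g : l2 D) : dilation_space H D Ds := ((0, 0), g).

Definition dilation (x : dilation_space H D Ds) : dilation_space H D Ds :=
  let gs := x.1.1 in let h := x.1.2 in let g := x.2 in
  ((l2_bshift gs, DTs (Vsa (l2_coef0 gs)) + T h),
   - l2_embed (V (Ts (Vsa (l2_coef0 gs)))) + l2_embed (V (DT h)) + l2_shift g).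

End Dilation.

Section WeightedL2.
Variable R : realType.
Local Notation mu := (@lebesgue_measure R).

Definition expi (t : R) : R[i] := (cos t +i* sin t)%C.

(* integral over the unit circle w.r.t. the normalized Lebesgue measure *)
Definition circle_integral (phi : R[i] -> R[i]) : R[i] :=
  (((2 * pi)^-1 * \int[mu]_(t in `[0, 2 * pi]) complex.Re (phi (expi t)))
   +i* ((2 * pi)^-1 * \int[mu]_(t in `[0, 2 * pi]) complex.Im (phi (expi t))))%C.

Variable E : innerProductType R.

(* Strong (Bochner) measurability on the circle, in its pointwise form: every
   almost everywhere class of strongly measurable functions has such a
   representative. *)
Definition circle_measurable (f : R[i] -> E) : Prop :=
  exists s : nat -> R -> E,
    (forall n, finite_set (range (s n)) /\
       forall e, measurable (s n @^-1` [set e])) /\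
    (forall t, `[0, 2 * pi]%classic t ->
       s n t @[n --> \oo] --> f (expi t)).

(* An operator weight: at each point of the circle a nonnegative self-adjoint
   operator with a dense domain, possibly all of [E] and possibly not
   invertible (as [E] is complex, nonnegativity implies symmetry). *)
Record operator_weight : Type := OperatorWeight {
  wdom : R[i] -> set E;
  wop : R[i] -> E -> E;
  wdom_subspace : forall z, `|z| = 1 -> subspace_set (wdom z);
  wop_linear : forall z, `|z| = 1 -> linear_on (wdom z) (wop z);
  wdom_dense : forall z, `|z| = 1 -> closure (wdom z) = setT;
  wop_ge0 : forall z x, `|z| = 1 -> wdom z x -> 0 <= dot (wop z x) x;
  wop_selfadjoint : forall z x y, `|z| = 1 ->
    (forall u, wdom z u -> dot (wop z u) x = dot u y) ->
    wdom z x /\ wop z x = y }.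

Let closure_setT : closure [set: E] = setT.
Proof. by apply/seteqP; split=> // x _; exact: subset_closure. Qed.

Let dot_inj (x y : E) :
  (forall u, [set: E] u -> dot u x = dot u y) -> [set: E] x /\ x = y.
Proof.
move=> xy; split=> //; apply/eqP; rewrite -subr_eq0; apply/eqP/dot_eq0.
have dN (u v w : E) : dot u v = dot u w -> dot u (v - w) = 0.
  move=> uvw; rewrite dotC dotDl -scaleN1r dotZl mulN1r (dotC v u) (dotC w u).
  by rewrite uvw subrr conjC0.
exact/dN/xy.
Qed.

(* the weight of the unweighted space L^2(E) *)
Definition unit_weight : operator_weight :=
  @OperatorWeight (fun=> setT) (fun=> id)
    (fun _ _ => conj I (fun _ _ _ _ _ => I)) (fun _ _ _ _ _ _ _ => erefl)
    (fun _ _ => closure_setT) (fun _ x _ _ => dot_ge0 x)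
    (fun _ x y _ => @dot_inj x y).

Variable W : operator_weight.

Definition weighted_form (f g : R[i] -> E) : R[i] :=
  circle_integral (fun z => dot (wop W z (f z)) (g z)).

Definition weighted_sqint : set (R[i] -> E) := [set f |
  [/\ circle_measurable f,
      forall z, `|z| = 1 -> wdom W z (f z),
      circle_measurable (fun z => wop W z (f z)) &
      mu.-integrable `[0, 2 * pi] (fun t =>
        (complex.Re (dot (wop W (expi t) (f (expi t))) (f (expi t))))%:E)]].

(* [L], with [cls] mapping a function to its class, is L^2(W; E): the Hilbert
   space obtained from the square integrable functions with the form
   [weighted_form] by identifying functions at distance 0 and completing.  For
   [unit_weight] the map [cls] is onto, as L^2(E) is complete. *)
Record weighted_L2 (L : hilbertType R) (cls : (R[i] -> E) -> L) : Prop :=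
  WeightedL2 {
    cls_linear : linear_on weighted_sqint cls;
    cls_dot : forall f g, weighted_sqint f -> weighted_sqint g ->
      dot (cls f) (cls g) = weighted_form f g;
    cls_dense : closure (cls @` weighted_sqint) = setT }.

(* [M] is the bounded operator of multiplication by [phi]. *)
Record multiplication_operator (L : hilbertType R) (cls : (R[i] -> E) -> L)
    (phi : R[i] -> R[i]) (M : L -> L) : Prop := MultiplicationOperator {
  mult_linear : linear_on setT M;
  mult_bounded : exists c : R[i], forall x, `|M x| <= c * `|x|;
  mult_cls : forall f, weighted_sqint f ->
    M (cls f) = cls (fun z => phi z *: f z) }.

End WeightedL2.

(* [Psi] is the unitary operator Psi^* from the dilation space X onto the closed
   subspace [K] of L^2(W; E). *)
Record transcription (R : realType) (X E : innerProductType R) (U : X -> X)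
    (W : operator_weight E) (L : hilbertType R) (cls : (R[i] -> E) -> L)
    (Mz : L -> L) (K : set L) (Psi : X -> L) : Prop := Transcription {
  trans_L2 : weighted_L2 W cls;
  trans_Mz : multiplication_operator W cls id Mz;
  trans_closed : closed_subspace K;
  trans_unitary : unitary_on setT K Psi;
  trans_intertwine : forall x, Psi (U x) = Mz (Psi x) }.

Section Model.
Variables (R : realType) (H D Ds : innerProductType R) (L : hilbertType R).
Variables (Psi : dilation_space H D Ds -> L) (Mz : L -> L).

Definition model_space : set L := range (fun h => Psi (in_H D Ds h)).

Definition model_operator (x : L) : L := orthoproj model_space (Mz x).

(* (D_A restricted to its defect space)^(-1), for [DA] the defect operator of
   an operator A on [S] *)
Definition inv_defect (S : set L) (DA : L -> L) : L -> L :=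
  'pinv_(fun=> 0) (defect_space S DA) DA.

Definition C_star_rhs (e : Ds) : L :=
  orthoproj model_space (Mz (Psi (in_Gs H D (l2_embed e)))).

Definition C_rhs (Mzbar : L -> L) (e : D) : L :=
  orthoproj model_space (Mzbar (Psi (in_G H Ds (l2_embed e)))).

Definition C_star_op (DMs : L -> L) (e : Ds) : L :=
  inv_defect model_space DMs (C_star_rhs e).

Definition C_op (DM Mzbar : L -> L) (e : D) : L :=
  inv_defect model_space DM (C_rhs Mzbar e).

End Model.

(* Main.v *)
Require Import Defs.
From HB Require Import structures.
From mathcomp Require Import all_boot all_order all_algebra.
From mathcomp Require Import complex ring lra.
From mathcomp Require Import all_classical all_reals all_analysis.
From mathcomp Require Import measurable_realfun.

Set Implicit Arguments.
Unset Strict Implicit.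
Unset Printing Implicit Defensive.

Import Order.TTheory GRing.Theory Num.Theory numFieldNormedType.Exports.

Import HBNNSimple.

Local Open Scope classical_set_scope.
Local Open Scope ring_scope.

(** Write [J h = Psi (in_H h)]: it is an isometry of [H] onto the model space
[K], and the whole statement is its claim transported from [H] to [K] by [J].

Projecting [Psi u] on [K] keeps only the middle component of [u]
([orthoproj_model_dilation]).  As [Psi] intertwines the dilation with [Mz], the
middle row of the dilation matrix gives [M J = J T] ([model_operatorE]) and
[C_star_rhs = J DTs Vsa] ([C_star_rhsE]).  For the other right-hand side the
last row is read backwards: [Mzbar] is the adjoint of [Mz], so the pairing of
[C_rhs e] with [J k] is the pairing of [e] with [V (DT k)], and
[C_rhs = J DT Va] ([C_rhsE]).

From [M J = J T] and the uniqueness of nonnegative square roots, [DM J = J DT]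
and [DMs J = J DTs] ([sqrt_on_transport]); hence [J] carries the defect spaces
of [T] and [Ts] onto those of [M] and [Ms].  Since [Va] takes its values in the
closure of the range of [DT], where [DT] is injective, solving
[DM (C e) = J DT Va e] gives [C = J Va], and likewise [Cs = J Vsa].  With [Phi]
the inverse of [J], these two formulas contain all the claims
([coordinate_agreement]).

Two facts carry the analysis.  The first is the uniqueness of the nonnegative
square root ([sqrt_on_unique]), obtained without functional calculus from a
self-improving norm bound.  The second is that [Mz] and [Mzbar] are adjoint
([mult_adjoint]): the formula holds for square integrable functions, which
multiplication by a measurable unimodular function preserves, and these
functions are dense. *)

(** * Linear operators and inner products *)

Section LinearOn.
Variables (R : realType) (A B : lmodType R[i]) (S : set A) (f : A -> B).
Hypotheses (subS : subspace_set S) (lin : linear_on S f).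

Lemma linear_on0 : f 0 = 0.
Proof.
have := lin 1 subS.1 subS.1; rewrite !scale1r addr0.
by rewrite -[X in X = _]add0r => /addIr.
Qed.

Lemma linear_onZ a x : S x -> f (a *: x) = a *: f x.
Proof.
by move=> Sx; have := lin a Sx subS.1; rewrite !addr0 linear_on0 addr0.
Qed.

Lemma linear_onD x y : S x -> S y -> f (x + y) = f x + f y.
Proof. by move=> Sx Sy; have := lin 1 Sx Sy; rewrite !scale1r. Qed.

Lemma linear_onB x y : S x -> S y -> f (x - y) = f x - f y.
Proof.
move=> Sx Sy; have := lin (-1) Sy Sx.
by rewrite !scaleN1r addrC => ->; rewrite addrC.
Qed.

End LinearOn.

Lemma subspace_setT (R : realType) (A : lmodType R[i]) :
  subspace_set [set: A].
Proof. by []. Qed.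

Section InnerProduct.
Variables (R : realType) (A : innerProductType R).
Implicit Types x y z : A.

Lemma dotDr x y z : dot x (y + z) = dot x y + dot x z.
Proof. by rewrite dotC dotDl rmorphD/= -!dotC. Qed.

Lemma dotZr (a : R[i]) x y : dot x (a *: y) = a^* * dot x y.
Proof. by rewrite dotC dotZl rmorphM/= -dotC. Qed.

Lemma dotNl x y : dot (- x) y = - dot x y.
Proof. by rewrite -scaleN1r dotZl mulN1r. Qed.

Lemma dotNr x y : dot x (- y) = - dot x y.
Proof. by rewrite dotC dotNl rmorphN/= -dotC. Qed.

Lemma dotBl x y z : dot (x - y) z = dot x z - dot y z.
Proof. by rewrite dotDl dotNl. Qed.

Lemma dotBr x y z : dot x (y - z) = dot x y - dot x z.
Proof. by rewrite dotDr dotNr. Qed.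

Lemma dot_extl x y : (forall u, dot x u = dot y u) -> x = y.
Proof.
move=> xy; apply/subr0_eq/dot_eq0.
by rewrite dotBl xy subrr.
Qed.

(** The square of the norm of [|y|^2 x - (x, y) y], divided by [|y|^2]. *)
Lemma cauchy_schwarz x y : `|dot x y| <= `|x| * `|y|.
Proof.
have [->|y0] := eqVneq y 0; first by rewrite dot0r !normr0 mulr0.
have yy : 0 < `|y| ^+ 2 by rewrite exprn_gt0// normr_gt0.
have yC : (`|y| ^+ 2)^* = `|y| ^+ 2 by rewrite conj_Creal// realX// normr_real.
rewrite -(@ler_pXn2r _ 2)// ?nnegrE ?mulr_ge0// exprMn -(ler_pM2l yy).
have := dot_ge0 (`|y| ^+ 2 *: x - dot x y *: y).
rewrite dotBl !dotBr !dotZl !dotZr yC -!normr_dot (dotC y x) normCK -subr_ge0.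
set a := `|x| ^+ 2; set b := `|y| ^+ 2; set c := dot x y => h.
by apply: (le_trans h); rewrite le_eqVlt; apply/orP; left; apply/eqP; ring.
Qed.

Lemma closure_dist (S : set A) x :
  closure S x <-> forall e : R[i], 0 < e -> exists2 a, S a & `|x - a| < e.
Proof.
split=> [clx e e0|h B /nbhs_normP[e /= e0 xB]].
  have [|a [Sa /= ?]] := clx [set a | `|x - a| < e]; last by exists a.
  by apply/nbhs_normP; exists e.
by have [a Sa xa] := h e e0; exists a; split=> //; apply: xB.
Qed.

(** The bound is stated with an arbitrary scalar [c], so that no sign condition
is needed where it is applied; the proof replaces [c] by its norm. *)
Lemma bounded_vanish_closure (S : set A) (g : A -> R[i]) (c : R[i]) :
  {morph g : x y / x - y} -> (forall x, `|g x| <= c * `|x|) ->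
  (forall x, S x -> g x = 0) -> forall x, closure S x -> g x = 0.
Proof.
move=> gB gc gS x /closure_dist clx; apply/eqP/negPn/negP => gx.
have c0 : 0 < `|c| + 1 by rewrite ltr_wpDl.
have [|a Sa] := clx (`|g x| / (`|c| + 1)).
  by rewrite divr_gt0// normr_gt0.
rewrite ltr_pdivlMr// -[g x]subr0 -(gS a Sa) -gB => /lt_geF/negP; apply.
have cxa : c * `|x - a| \is Num.real.
  by rewrite ger0_real// (le_trans _ (gc _)).
apply: (le_trans (gc _)); apply: (le_trans (real_ler_norm cxa)).
by rewrite normrM normr_id mulrC ler_wpM2l// lerDl.
Qed.

Lemma orthogonal_closure (S : set A) x :
  (forall s, S s -> dot s x = 0) -> forall s, closure S s -> dot s x = 0.
Proof.
move=> xS; apply: (@bounded_vanish_closure _ (dot^~ x) `|x|) => // [y z|y].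
  by rewrite dotBl.
by rewrite mulrC cauchy_schwarz.
Qed.

Lemma orthoproj_eq (S : set A) x p : subspace_set S ->
  S p -> orthogonal_to S (x - p) -> orthoproj S x = p.
Proof.
move=> [S0 Slin] Sp xp; apply: xget_subset1 => //.
move=> q r [/= Sq xq] [/= Sr xr]; apply/subr0_eq/dot_eq0.
have Sqr : S (q - r) by rewrite addrC -scaleN1r; exact: Slin.
by rewrite -[X in dot X _](subrKA x) dotDl -opprB dotNl xq// xr// oppr0 addr0.
Qed.

End InnerProduct.

Section TwoSpaceLemmas.
Variables (R : realType) (A B : innerProductType R).

Lemma adjoint_dot (f : A -> B) (g : B -> A) : adjoint_on setT setT f g ->
  forall x y, dot (f x) y = dot x (g y).
Proof. by case=> _ _ fg x y; exact: fg. Qed.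

Lemma adjoint_dotV (f : A -> B) (g : B -> A) : adjoint_on setT setT f g ->
  forall x y, dot (g y) x = dot y (f x).
Proof. by move=> fg x y; rewrite dotC -(adjoint_dot fg) -dotC. Qed.

Lemma adjoint_linear (f : A -> B) (g : B -> A) :
  adjoint_on setT setT f g -> linear_on setT g.
Proof.
move=> fg a x y _ _; apply: dot_extl => u.
by rewrite dotDl dotZl !(adjoint_dotV fg) dotDl dotZl.
Qed.

Lemma isometry_norm (S : set A) (f : A -> B) :
  (forall x y, S x -> S y -> dot (f x) (f y) = dot x y) ->
  forall x, S x -> `|f x| = `|x|.
Proof.
move=> fS x Sx; apply/eqP; rewrite -(@eqrXn2 _ 2)//.
by rewrite !normr_dot fS.
Qed.

End TwoSpaceLemmas.

(** * Uniqueness of the nonnegative square root *)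

Section SquareRoot.
Variables (R : realType) (A : innerProductType R).
Implicit Types x y : A.

(* Only the real part of the inner product matters, so that all the estimates
   below are linear arithmetic over [R]. *)
Let rdot x y : R := complex.Re (dot x y).
Let sq x : R := rdot x x.

Let rdotC x y : rdot x y = rdot y x.
Proof. by rewrite /rdot (dotC y x); case: (dot x y). Qed.

Let rdotDl x y z : rdot (x + y) z = rdot x z + rdot y z.
Proof. by rewrite /rdot dotDl; case: (dot x z); case: (dot y z). Qed.

Let rdotBl x y z : rdot (x - y) z = rdot x z - rdot y z.
Proof. by rewrite /rdot dotBl; case: (dot x z); case: (dot y z). Qed.

Let rdotDr x y z : rdot x (y + z) = rdot x y + rdot x z.
Proof. by rewrite !(rdotC x) rdotDl. Qed.

Let rdotBr x y z : rdot x (y - z) = rdot x y - rdot x z.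
Proof. by rewrite !(rdotC x) rdotBl. Qed.

Let rdotNr x y : rdot x (- y) = - rdot x y.
Proof. by rewrite /rdot dotNr; case: (dot x y). Qed.

Let rdotZl (k : R) x y : rdot (k%:C%C *: x) y = k * rdot x y.
Proof.
by rewrite /rdot dotZl; case: (dot x y) => a b /=; rewrite mul0r subr0.
Qed.

Let rdotZr (k : R) x y : rdot x (k%:C%C *: y) = k * rdot x y.
Proof. by rewrite !(rdotC x) rdotZl. Qed.

Let sq_ge0 x : 0 <= sq x.
Proof. by have := dot_re x; rewrite nnegrE. Qed.

Let sq_eq0 x : sq x <= 0 -> x = 0.
Proof.
move=> sx; apply: dot_eq0; have := dot_im x.
have : complex.Re (dot x x) = 0 by apply: le_anti; rewrite sx sq_ge0.
by case: (dot x x) => a b /= -> ->.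
Qed.

Let sqB x y : sq (x - y) = sq x - 2 * rdot x y + sq y.
Proof. rewrite /sq rdotBl !rdotBr (rdotC y x); ring. Qed.

Let sqD x y : sq (x + y) = sq x + 2 * rdot x y + sq y.
Proof. rewrite /sq rdotDl !rdotDr (rdotC y x); ring. Qed.

Let sqZ (k : R) x : sq (k%:C%C *: x) = k ^+ 2 * sq x.
Proof. by rewrite /sq rdotZl rdotZr mulrA. Qed.

(* Young's inequality, with the weight [8 / k ^+ 2]; any weight above
   [4 / k ^+ 2] makes the bound [improve] of the next proof smaller than [k]. *)
Let young_sq (k : R) x y :
  k ^+ 2 * rdot x y <= 4 * sq x + k ^+ 4 / 16 * sq y.
Proof.
have := sq_ge0 ((8 : R)%:C%C *: x - (k ^+ 2)%:C%C *: y).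
have -> : k ^+ 4 = (k ^+ 2) ^+ 2 by ring.
rewrite sqB !sqZ rdotZl rdotZr; lra.
Qed.

(** Let [C = D1 - D2] and [S = D1 + D2].  As [D1] and [D2] have the same square,
[C S = - S C], so [(C C x, S x) = - (S C x, C x) <= 0]; and since [D1] and [D2]
are at most 1, [|C x|^2 <= 2 (S x, x)].  Suppose [|C x|^2 <= k |x|^2] for all
[x].  Where this bound is almost attained, [C C x] is almost [k x], so that
[k (S x, x)] is almost [(C C x, S x)], which is nonpositive, and [C x] is small:
the bound cannot be sharp unless [k = 0].  Quantitatively [k] can be replaced by
[k - k^3 / (2 (k^2 + 8))], and the least admissible [k] is therefore 0. *)
Lemma sqrt_on_unique (P D1 D2 : A -> A) :
  (forall x, complex.Re (dot (P x) x) <= complex.Re (dot x x)) ->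
  sqrt_on setT P D1 -> sqrt_on setT P D2 -> D1 =1 D2.
Proof.
move=> P1 [l1 a1 p1 s1] [l2 a2 p2 s2].
have sa D (aD : adjoint_on setT setT D D) x y : rdot (D x) y = rdot x (D y).
  by rewrite /rdot (adjoint_dot aD).
have subT := subspace_setT A.
have contr D (lD : linear_on setT D) (aD : adjoint_on setT setT D D)
    (pD : forall x, [set: A] x -> 0 <= dot (D x) x)
    (sD : forall x, [set: A] x -> D (D x) = P x) x :
    sq (D x) <= sq x /\ sq (D x) <= rdot (D x) x.
  have pos y : 0 <= rdot (D y) y by have := pD y I; rewrite lecE => /andP[].
  have c1 y : sq (D y) <= sq y.
    by rewrite /sq sa// sD//; have := P1 y; rewrite -rdotC.
  have c2 : rdot (D (D x)) (D x) <= sq (D x).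
    have := sq_ge0 (D (D x) - D x); rewrite sqB.
    have := c1 (D x); lra.
  split => //; have := pos (x - D x).
  rewrite (linear_onB lD)// rdotBl !rdotBr (sa D aD (D x) x) -/(sq (D x)); lra.
pose C x := D1 x - D2 x; pose S x := D1 x + D2 x.
have saC x y : rdot (C x) y = rdot x (C y).
  by rewrite /C rdotBl rdotBr !sa.
have CS x : C (S x) = - S (C x).
  rewrite /C /S (linear_onD l1)// (linear_onD l2)// (linear_onB l1)//.
  rewrite (linear_onB l2)// s1// s2//.
  set p := P x; set a := D1 _; set b := D2 _.
  rewrite [b + p]addrC opprD addrACA subrr add0r.
by rewrite [p - a + _]addrC addrA subrK opprB.
have QS x : rdot (C (C x)) (S x) <= 0.
  rewrite saC CS rdotNr rdotC.
  have := p1 (C x) I; have := p2 (C x) I; rewrite !lecE => /andP[_ +] /andP[_].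
  rewrite /S rdotDl /rdot /=; lra.
have CleS x : sq (C x) <= 2 * rdot (S x) x.
  have [_ c1] := contr _ l1 a1 p1 s1 x; have [_ c2] := contr _ l2 a2 p2 s2 x.
  have := sq_ge0 (D1 x + D2 x); rewrite sqD sqB /S rdotDl; lra.
have Sle x : sq (S x) <= 4 * sq x.
  have [c1 _] := contr _ l1 a1 p1 s1 x; have [c2 _] := contr _ l2 a2 p2 s2 x.
  have := sq_ge0 (D1 x - D2 x); rewrite sqB sqD; lra.
pose bounds : set R := [set k | 0 <= k /\ forall x, sq (C x) <= k * sq x].
have bounds4 : bounds 4.
  split=> // x.
  have [c1 _] := contr _ l1 a1 p1 s1 x; have [c2 _] := contr _ l2 a2 p2 s2 x.
  have := sq_ge0 (D1 x + D2 x); rewrite sqB sqD; lra.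
have bounds_lb : lbound bounds 0 by move=> k [].
have bounds_inf : bounds (inf bounds).
  split=> [|x]; first by apply: lb_le_inf => //; exists 4.
  have := sq_ge0 x; rewrite le_eqVlt => /predU1P[x0|x0].
    by have [_ /(_ x)] := bounds4; rewrite -x0 !mulr0.
  rewrite -ler_pdivrMr//; apply: lb_le_inf; first by exists 4.
  by move=> k [_ /(_ x)]; rewrite ler_pdivrMr.
have improve k : 0 < k -> bounds k -> bounds (k - k ^+ 3 / (2 * (k ^+ 2 + 8))).
  move=> k0 [_ kC].
  have d0 : 0 < k ^+ 2 + 8 by rewrite ltr_wpDl// sqr_ge0.
  split=> [|x].
    rewrite subr_ge0 ler_pdivrMr ?mulr_gt0// exprSr mulrC ler_pM2l//.
    by have := sqr_ge0 k; lra.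
  (* [y] measures how far [C C x] is from [k x]; it is small where the bound [k]
     is almost attained. *)
  pose y := k%:C%C *: x - C (C x).
  have yle : sq y <= k ^+ 2 * sq x - k * sq (C x).
    rewrite /y sqB sqZ rdotZl -saC; have := kC (C x).
    rewrite -/(sq (C x)); lra.
  have yS : k * rdot (S x) x <= rdot y (S x).
    rewrite /y rdotBl rdotZl rdotC; have := QS x; lra.
  have -> : k - k ^+ 3 / (2 * (k ^+ 2 + 8)) =
      (8 * k + k ^+ 3 / 2) / (k ^+ 2 + 8).
    by field; apply: lt0r_neq0.
  rewrite mulrAC ler_pdivlMr// -(ler_pM2l k0).
  have Cle : k * sq (C x) <= 2 * rdot y (S x).
    have := ler_wpM2l (ltW k0) (CleS x); move: yS; rewrite mulrCA; lra.
  have := ler_wpM2l (sqr_ge0 k) Cle.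
  have k4 : 0 <= k ^+ 4 / 16 by rewrite divr_ge0// exprn_ge0// ltW.
  have := ler_wpM2l k4 (Sle x); have := young_sq k y (S x).
  move: yle; move: (sq y) (rdot _ _) (sq (C x)) (sq (S x)) (sq x) => a b c d e.
  lra.
suff inf0 : inf bounds = 0.
  move=> x; apply/subr0_eq/sq_eq0.
  by have := bounds_inf.2 x; rewrite inf0 mul0r.
apply/eqP/negPn/negP => inf_neq0.
have inf_gt0 : 0 < inf bounds by rewrite lt_def inf_neq0 bounds_inf.1.
have := ge_inf (ex_intro _ 0 bounds_lb) (improve _ inf_gt0 bounds_inf).
rewrite leNgt ltrBlDr ltrDl divr_gt0 ?exprn_gt0// mulr_gt0//.
by rewrite ltr_wpDl// sqr_ge0.
Qed.

End SquareRoot.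

Lemma defect_le (R : realType) (A : innerProductType R) (T Ts : A -> A) :
  adjoint_on setT setT T Ts -> forall x,
  complex.Re (dot (x - Ts (T x)) x) <= complex.Re (dot x x).
Proof.
move=> TTs x; have := dot_ge0 (T x).
rewrite dotBl (adjoint_dotV TTs) !lecE => /andP[_].
by case: (dot x x) (dot (T x) (T x)) => [a b] [c d] /= c0; rewrite gerBl.
Qed.

(** * Multiplication operators on the weighted space *)

Lemma adjoint_closure (R : realType) (A B : innerProductType R) (S : set A)
    (M : A -> B) (c : R[i]) (y : B) (v : A) :
  linear_on setT M -> (forall x, `|M x| <= c * `|x|) ->
  (forall x, S x -> dot (M x) y = dot x v) ->
  forall x, closure S x -> dot (M x) y = dot x v.
Proof.
move=> Ml Mc MS x Sx; apply/eqP; rewrite -subr_eq0; apply/eqP.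
apply: (@bounded_vanish_closure _ _ S (fun x => dot (M x) y - dot x v)
  (c * `|y| + `|v|)) => // [u w|u|u Su].
- rewrite (linear_onB Ml)// !dotBl; ring.
- rewrite (le_trans (ler_normB _ _))// mulrDl lerD//.
    by rewrite (le_trans (cauchy_schwarz _ _))// mulrAC ler_wpM2r.
  by rewrite (le_trans (cauchy_schwarz _ _))// mulrC.
- by rewrite MS// subrr.
Qed.

(** The approximants in [circle_measurable]. *)
Definition simple_map (R : realType) (X : Type) (s : R -> X) : Prop :=
  finite_set (range s) /\ forall e, measurable (s @^-1` [set e]).

Section SimpleMap.
Variable R : realType.

(** The fibre of the combined map is a finite union, over the pairs of values of
[a] and [b], of intersections of fibres. *)
Lemma simple_map_comp (X Y Z : Type) (phi : X -> Y -> Z) (a : R -> X)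
    (b : R -> Y) :
  simple_map a -> simple_map b -> simple_map (fun t => phi (a t) (b t)).
Proof.
move=> [fa ma] [fb mb]; pose ab := range a `*` range b.
have fab : finite_set ab by exact: finite_setX.
split=> [|e].
  apply: sub_finite_set (finite_image (fun p => phi p.1 p.2) fab).
  by move=> _ [t _ <-]; exists (a t, b t) => //; split; exists t.
rewrite (_ : _ @^-1` _ = \bigcup_(p in ab `&` [set p | phi p.1 p.2 = e])
    (a @^-1` [set p.1] `&` b @^-1` [set p.2])).
  apply: fin_bigcup_measurable => [|p _]; first exact: finite_setIl.
  exact: measurableI.
apply/seteqP; split=> [t /= <-|t [p [_ /= <-]] [-> ->]//].
by exists (a t, b t) => //; split=> //; split; exists t.
Qed.

(** The bound below reduces to the standard approximation of nonnegative
measurable functions, applied to [f + k]. *)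
Lemma simple_approx (f : R -> R) (k : R) : measurable_fun setT f ->
  (forall t, - k <= f t) ->
  exists s : nat -> R -> R, (forall n, simple_map (s n)) /\
    forall t, s n t @[n --> \oo] --> f t.
Proof.
move=> mf fk; pose g t := (f t + k)%:E.
have mg : measurable_fun setT g.
  by apply/measurable_EFinP; apply: measurable_funD.
have g0 t : [set: R] t -> (0 <= g t)%E.
  by move=> _; rewrite lee_fin -lerBlDr sub0r.
pose h := nnsfun_approx measurableT mg.
exists (fun n t => h n t - k); split=> [n|t].
  have sh : simple_map (h n).
    by split=> [|e]; [exact: fimfunP|exact: measurable_sfunP].
  exact: (simple_map_comp (fun x _ => x - k) sh sh).
rewrite -[f t](addrK k); apply: cvgB; last exact: cvg_cst.
by have /fine_cvgP[] := cvg_nnsfun_approx measurableT mg g0 (I : setT t).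
Qed.

Lemma simple_approx_expi : exists s : nat -> R -> R[i],
  (forall n, simple_map (s n)) /\
  forall t, s n t @[n --> \oo] --> (expi t : (R[i] : numFieldType)).
Proof.
have [c [sc cc]] : exists s : nat -> R -> R, (forall n, simple_map (s n)) /\
    forall t, s n t @[n --> \oo] --> cos t.
  apply: (@simple_approx _ 1) => [|t]; last exact: cos_geN1.
  by apply: continuous_measurable_fun; exact: continuous_cos.
have [d [sd cd]] : exists s : nat -> R -> R, (forall n, simple_map (s n)) /\
    forall t, s n t @[n --> \oo] --> sin t.
  apply: (@simple_approx _ 1) => [|t]; last exact: sin_geN1.
  by apply: continuous_measurable_fun; exact: continuous_sin.
exists (fun n t => (c n t +i* d n t)%C); split=> [n|t].
  exact: (simple_map_comp (fun x y => (x +i* y)%C)).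
apply/(@cvgrPdist_lt _ (R[i] : numFieldType)^o) => e e0.
have eE : e = (complex.Re e)%:C%C.
  by rewrite (RRe_real (gtr0_real e0)).
move: e0; rewrite eE ltcR => r0; set r := complex.Re e in r0 *.
have r20 : 0 < r / 2 by rewrite divr_gt0.
near=> n.
have cn : `|cos t - c n t| < r / 2.
  by near: n; move/cvgrPdist_lt : (cc t); apply.
have dn : `|sin t - d n t| < r / 2.
  by near: n; move/cvgrPdist_lt : (cd t); apply.
rewrite /expi normc_def /= ltcR -(@ltr_pXn2r _ 2)// ?nnegrE ?sqrtr_ge0 ?ltW//.
rewrite sqr_sqrtr ?addr_ge0 ?sqr_ge0//.
rewrite -(real_normK (num_real (cos t - _))).
rewrite -(real_normK (num_real (sin t - _))).
move: (normr_ge0 (cos t - c n t)) (normr_ge0 (sin t - d n t)) cn dn.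
by move: `|cos t - _| `|sin t - _| => a b; nra.
Unshelve. all: by end_near.
Qed.

End SimpleMap.

Section WeightedMultiplication.
Variables (R : realType) (E : innerProductType R) (W : operator_weight E).

Lemma expi_norm (t : R) : `|expi t| = 1.
Proof. by rewrite normc_def /= cos2Dsin2 sqrtr1. Qed.

(** The second clause is strong measurability on the circle: it makes
multiplication by [phi] preserve [circle_measurable]. *)
Definition circle_multiplier (phi : R[i] -> R[i]) : Prop :=
  (forall z, `|z| = 1 -> phi z * (phi z)^* = 1) /\
  exists s : nat -> R -> R[i], (forall n, simple_map (s n)) /\
    forall t, s n t @[n --> \oo] --> (phi (expi t) : (R[i] : numFieldType)).

Lemma circle_measurable_mul (phi : R[i] -> R[i]) (f g : R[i] -> E) :
  circle_multiplier phi -> circle_measurable f ->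
  (forall z, `|z| = 1 -> g z = phi z *: f z) -> circle_measurable g.
Proof.
move=> [_ [s [ss sphi]]] [r [sr rf]] gE.
exists (fun n t => s n t *: r n t); split=> [n|t t2pi].
  exact: (simple_map_comp (fun x y => x *: y) (ss n) (sr n)).
rewrite gE ?expi_norm//.
exact: cvgZ (sphi t) (rf t t2pi).
Qed.

Lemma wopZ z a x : `|z| = 1 -> wdom W z x -> wop W z (a *: x) = a *: wop W z x.
Proof.
move=> z1; apply: (linear_onZ (wdom_subspace W z1) (wop_linear z1)).
Qed.

Lemma wdomZ z a x : `|z| = 1 -> wdom W z x -> wdom W z (a *: x).
Proof.
move=> z1 zx; have [z0 zl] := wdom_subspace W z1.
by rewrite -[_ *: _]addr0; exact: zl.
Qed.

(** A unimodular factor commutes with the weight at each point of the circle, so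
it does not change the integrand of the norm. *)
Lemma weighted_sqint_mul (phi : R[i] -> R[i]) (f : R[i] -> E) :
  circle_multiplier phi -> weighted_sqint W f ->
  weighted_sqint W (fun z => phi z *: f z).
Proof.
move=> mphi [mf df mWf If]; split.
- exact: (circle_measurable_mul mphi mf).
- by move=> z z1; apply: wdomZ => //; exact: df.
- by apply: (circle_measurable_mul mphi mWf) => z z1; rewrite wopZ//; exact: df.
- apply: eq_integrable If => // t _; congr (complex.Re _)%:E.
  rewrite wopZ ?expi_norm//; last by apply: df; rewrite expi_norm.
  by rewrite dotZl dotZr mulrA mphi.1 ?expi_norm// mul1r.
Qed.

Lemma circle_integral_eq (phi psi : R[i] -> R[i]) :
  (forall z, `|z| = 1 -> phi z = psi z) ->
  circle_integral phi = circle_integral psi.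
Proof.
move=> pp; rewrite /circle_integral; congr (_ * _ +i* (_ * _))%C;
  by apply: eq_Rintegral => t _; rewrite pp// expi_norm.
Qed.

Lemma circle_multiplier_id : circle_multiplier id.
Proof.
split=> [z z1|]; last exact: simple_approx_expi.
by rewrite -normCK z1 expr1n.
Qed.

Lemma circle_multiplier_conj : circle_multiplier (fun z => z^*).
Proof.
split=> [z z1|]; first by rewrite conjCK mulrC -normCK z1 expr1n.
have [s [ss se]] := @simple_approx_expi R.
exists (fun n t => (s n t)^*); split=> [n|t].
  exact: (simple_map_comp (fun x _ => x^*) (ss n) (ss n)).
apply/(@cvgrPdist_lt _ (R[i] : numFieldType)^o) => e e0.
have /(@cvgrPdist_lt _ (R[i] : numFieldType)^o)/(_ e e0) := se t.
by apply: filterS => n; rewrite -rmorphB norm_conjC.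
Qed.

(** On classes of functions both sides are the integral of the same function on
the circle; boundedness and density extend the equality, one variable at a
time. *)
Lemma mult_adjoint (L : hilbertType R) (cls : (R[i] -> E) -> L)
    (phi psi : R[i] -> R[i]) (M N : L -> L) :
  weighted_L2 W cls -> multiplication_operator W cls phi M ->
  multiplication_operator W cls psi N ->
  circle_multiplier phi -> circle_multiplier psi ->
  (forall z, `|z| = 1 -> psi z = (phi z)^*) ->
  forall x y, dot (M x) y = dot x (N y).
Proof.
move=> [_ cd dense] [Ml [c Mc] Mcls] [Nl [d Nd] Ncls] mphi mpsi pp.
have on_dense f g : weighted_sqint W f -> weighted_sqint W g ->
    dot (M (cls f)) (cls g) = dot (cls f) (N (cls g)).
  move=> sf sg; rewrite Mcls// Ncls// !cd//; try exact: weighted_sqint_mul.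
  apply: circle_integral_eq => z z1; have [_ df _ _] := sf.
  by rewrite (wopZ _ z1 (df z z1)) dotZl dotZr pp// conjCK.
move=> x y; apply: (adjoint_closure Ml Mc (S := cls @` weighted_sqint W)).
  move=> _ [f sf <-]; rewrite dotC [RHS]dotC; congr (_^*); apply/esym.
  apply: (adjoint_closure Nl Nd (S := cls @` weighted_sqint W)).
    by move=> _ [g sg <-]; rewrite dotC -on_dense// -dotC.
  by rewrite dense.
by rewrite dense.
Qed.

End WeightedMultiplication.

(** * Transport along an isometry *)

Section IsometricCopy.
Variables (R : realType) (H : innerProductType R) (L : hilbertType R).
Variables (J : H -> L) (Phi : L -> H).
Hypotheses (J_linear : linear_on setT J)
  (J_dot : forall h k, dot (J h) (J k) = dot h k)
  (PhiJ : cancel J Phi).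

Let J_norm h : `|J h| = `|h|.
Proof. by apply: (@isometry_norm _ _ _ setT). Qed.

Lemma isometry_inverse_unitary : unitary_on (range J) setT Phi.
Proof.
split=> [a _ _ [h _ <-] [k _ <-]||_ _ [h _ <-] [k _ <-]].
- by rewrite -J_linear// !PhiJ.
- apply/seteqP; split=> // h _.
  by exists (J h); [exists h|rewrite PhiJ].
- by rewrite !PhiJ J_dot.
Qed.

(** The inclusion from left to right needs a closed range: a limit of points of
[J @` S] must first be known to be of the form [J h]. *)
Lemma closure_isometry (S : set H) : closure (range J) `<=` range J ->
  closure (J @` S) = J @` closure S.
Proof.
move=> clJ; apply/seteqP; split=> [x clx|_ [h clh <-]].
  have [h _ hx] : range J x.
    by apply/clJ/(closureS _ clx) => _ [k _ <-]; exists k.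
  rewrite -{}hx in clx *; exists h => //.
  apply/closure_dist => e e0.
  have [_ [k Sk <-]] := (closure_dist _ _).1 clx e e0.
  by rewrite -(linear_onB J_linear)// J_norm; exists k.
apply/closure_dist => e e0; have [k Sk hk] := (closure_dist _ _).1 clh e e0.
by exists (J k); [exists k|rewrite -(linear_onB J_linear)// J_norm].
Qed.

(** [Phi \o DM \o J] is another nonnegative square root of [P]. *)
Lemma sqrt_on_transport (P DT : H -> H) (Q DM : L -> L) :
  (forall h, complex.Re (dot (P h) h) <= complex.Re (dot h h)) ->
  (forall h, Q (J h) = J (P h)) ->
  sqrt_on setT P DT -> sqrt_on (range J) Q DM ->
  forall h, DM (J h) = J (DT h).
Proof.
move=> P1 QJ sDT [DMl [DMK _ DMa] DMp DMQ] h.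
have Jrange k : range J (J k) by exists k.
have JPhi k : J (Phi (DM (J k))) = DM (J k).
  by have [k' _ <-] := DMK _ (Jrange k); rewrite PhiJ.
suff /(sqrt_on_unique P1 sDT) -> : sqrt_on setT P (Phi \o DM \o J).
  by rewrite /= JPhi.
split=> [a x y _ _||x _|x _] /=.
- rewrite J_linear// DMl//.
  by have [lin _ _] := isometry_inverse_unitary; rewrite lin//; exact: DMK.
- by split=> // x y _ _; rewrite -J_dot JPhi DMa// -JPhi J_dot.
- by rewrite -J_dot JPhi DMp.
- by rewrite JPhi DMQ// QJ PhiJ.
Qed.

Section Coordinates.
Variables (D : innerProductType R) (DT : H -> H) (DM : L -> L).
Variables (V : H -> D) (Va : D -> H) (rhs : D -> L).
Let S := defect_space setT DT.
Let defM := defect_space (range J) DM.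
Let C e := inv_defect (range J) DM (rhs e).
Hypotheses (closed_J : closure (range J) `<=` range J)
  (DT_linear : linear_on setT DT) (DT_adjoint : adjoint_on setT setT DT DT)
  (V_coord : coordinate_operator S V Va)
  (DMJ : forall h, DM (J h) = J (DT h))
  (rhsE : forall e, rhs e = J (DT (Va e))).

(** The vector [w = Va (V h) - h] is orthogonal to [S], because [V] is isometric
on [S]; hence [V w = 0] and [(w, Va (V h)) = (V w, V h) = 0], while
[(w, h) = 0]. *)
Lemma coord_adjointK h : S h -> Va (V h) = h.
Proof.
have [Vlin [_ _ Vdot] Vorth Vadj] := V_coord => Sh.
have orth_w : orthogonal_to S (Va (V h) - h).
  by move=> s Ss; rewrite dotBl (adjoint_dotV Vadj) Vdot// subrr.
apply/subr0_eq/dot_eq0; rewrite [LHS]dotBr (orth_w h Sh) subr0.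
by rewrite -(adjoint_dot Vadj) Vorth// dot0l.
Qed.

Lemma coord_adjoint_mem e : S (Va e).
Proof.
have [_ [_ Vonto _] _ _] := V_coord.
have [h Sh <-] : (V @` S) e by rewrite Vonto.
by rewrite coord_adjointK.
Qed.

Lemma coord_adjoint_dot e e' : dot (Va e) (Va e') = dot e e'.
Proof.
have [_ [_ Vonto Vdot] _ _] := V_coord.
have [h Sh <-] : (V @` S) e by rewrite Vonto.
have [h' Sh' <-] : (V @` S) e' by rewrite Vonto.
by rewrite !coord_adjointK// Vdot.
Qed.

Lemma defect_space_isometry : defM = J @` S.
Proof.
rewrite /S /defM /defect_space -closure_isometry//; congr closure.
apply/seteqP; split=> [_ [_ [h _ <-] <-]|_ [_ [h _ <-] <-]].
  by exists (DT h); [exists h|rewrite DMJ].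
by exists (J h); [exists h|rewrite DMJ].
Qed.

Lemma coord_adjoint_defect e : defM (J (Va e)).
Proof.
rewrite defect_space_isometry; exists (Va e) => //.
exact: coord_adjoint_mem.
Qed.

(** The kernel of the self-adjoint operator [DT] is orthogonal to its range. *)
Lemma defect_injective : {in defM &, injective DM}.
Proof.
rewrite defect_space_isometry => _ _ /set_mem[h Sh <-] /set_mem[k Sk <-].
rewrite !DMJ => /(can_inj PhiJ) DThk; congr J; apply/subr0_eq/dot_eq0.
have orth : forall s, S s -> dot s (h - k) = 0.
  apply: orthogonal_closure => _ [u _ <-].
  by rewrite (adjoint_dot DT_adjoint) (linear_onB DT_linear)// DThk subrr dot0r.
by rewrite [LHS]dotBl !orth// subrr.
Qed.

(* The formula from which all the assertions below follow. *)
Let CE e : C e = J (Va e).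
Proof.
rewrite /C rhsE -DMJ; apply: pinvKV; first exact: defect_injective.
by apply/mem_set; exact: coord_adjoint_defect.
Qed.

(** Applied to [DT], [V] it concerns the operator [C], and to [DTs], [Vs] the
operator [Cs]. *)
Lemma coordinate_agreement :
  [/\ {in defM &, injective DM} /\ forall e, (DM @` defM) (rhs e),
      unitary_on setT defM C, Phi @` defM `<=` S &
      adjoint_on setT defM C (V \o Phi)].
Proof.
have [_ [_ _ Vdot] _ Vadj] := V_coord.
split.
- split=> [|e]; first exact: defect_injective.
  by exists (J (Va e)); [exact: coord_adjoint_defect|rewrite rhsE DMJ].
- split=> [a x y _ _||x y _ _]; rewrite ?CE.
  + by rewrite (adjoint_linear Vadj)// J_linear.
  + apply/seteqP; split=> [_ [e _ <-]|].
      by rewrite CE; exact: coord_adjoint_defect.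
    rewrite defect_space_isometry => _ [h Sh <-].
    by exists (V h) => //; rewrite CE coord_adjointK.
  + by rewrite J_dot coord_adjoint_dot.
- by rewrite defect_space_isometry => _ [_ [h Sh <-] <-]; rewrite PhiJ.
- split=> [e _|//|e x _]; first by rewrite CE; exact: coord_adjoint_defect.
  rewrite defect_space_isometry CE => -[h Sh <-] /=.
  by rewrite PhiJ J_dot (adjoint_dotV Vadj).
Qed.

End Coordinates.
End IsometricCopy.

(** * The model space and the model operator *)

Section ModelSpace.
Variables (R : realType) (H D Ds : innerProductType R) (L : hilbertType R).
Variables (Psi : dilation_space H D Ds -> L) (Kt : set L).
Hypotheses (Psi_unitary : unitary_on setT Kt Psi) (Kt_closed : closed Kt).

Let J h := Psi (in_H D Ds h).

Lemma model_embedding_linear : linear_on setT J.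
Proof.
move=> a x y _ _; have [lin _ _] := Psi_unitary.
rewrite /J -lin//; congr Psi.
rewrite -[RHS]/(((a *: 0 + 0, a *: x + y), a *: 0 + 0) : dilation_space H D Ds).
by rewrite !scaler0 !addr0.
Qed.

Lemma dot_in_H (u : dilation_space H D Ds) h :
  dot u (in_H D Ds h) = dot u.1.2 h.
Proof. by rewrite !hsum_dotE /= !dot0r add0r addr0. Qed.

Lemma dot_model_embedding u h : dot (Psi u) (J h) = dot u.1.2 h.
Proof. by have [_ _ ->] := Psi_unitary; rewrite ?dot_in_H. Qed.

Lemma model_embedding_dot h k : dot (J h) (J k) = dot h k.
Proof. exact: dot_model_embedding. Qed.

Lemma model_subspace : subspace_set (range J).
Proof.
split=> [|a _ _ [h _ <-] [k _ <-]]; last first.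
  by exists (a *: h + k) => //; rewrite model_embedding_linear.
exists 0 => //.
exact: (linear_on0 (subspace_setT _) model_embedding_linear).
Qed.

Lemma orthoproj_model x h : (forall k, dot x (J k) = dot h k) ->
  orthoproj (range J) x = J h.
Proof.
move=> xh; apply: orthoproj_eq; [exact: model_subspace|by exists h|].
by move=> _ [k _ <-]; rewrite dotBl xh model_embedding_dot subrr.
Qed.

Lemma orthoproj_model_dilation u : orthoproj (range J) (Psi u) = J u.1.2.
Proof. by apply: orthoproj_model => k; exact: dot_model_embedding. Qed.

(** If [Psi u] is a limit of points of the model space, the part [p] of [u]
outside [H] is orthogonal to itself, since [Psi p] is orthogonal to the model
space and hence to its closure. *)
Lemma model_space_closed : closure (range J) `<=` range J.
Proof.
have [lin onto Pdot] := Psi_unitary.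
move=> x clx; have : Kt x.
  apply: Kt_closed; apply: closureS clx => _ [h _ <-].
  by rewrite -onto; exists (in_H D Ds h).
rewrite -onto => -[u _ xE]; rewrite -{}xE in clx *.
pose p : dilation_space H D Ds := u - in_H D Ds u.1.2.
have p0 h : dot (J h) (Psi p) = 0.
  by rewrite dotC dot_model_embedding /= subrr dot0l conjC0.
suff : p = 0 by move=> /subr0_eq ->; exists u.1.2.
apply: dot_eq0; rewrite -Pdot//.
have pE : Psi p = Psi u - J u.1.2 by rewrite (linear_onB lin).
rewrite [X in dot X _]pE.
rewrite dotBl p0 subr0.
by apply: (orthogonal_closure _ clx) => _ [h _ <-].
Qed.

End ModelSpace.

Section ModelOperator.
Variables (R : realType) (H D Ds : innerProductType R) (L : hilbertType R).
Variables (T Ts DT DTs : H -> H).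
Variables (V : H -> D) (Va : D -> H) (Vs : H -> Ds) (Vsa : Ds -> H).
Variables (Psi : dilation_space H D Ds -> L) (Kt : set L) (Mz Mzbar : L -> L).
Hypotheses (T_linear : linear_on setT T) (DTs_linear : linear_on setT DTs)
  (Ts_linear : linear_on setT Ts) (V_linear : linear_on setT V)
  (Vsa_linear : linear_on setT Vsa)
  (DT_adjoint : adjoint_on setT setT DT DT)
  (V_adjoint : adjoint_on setT setT V Va)
  (Psi_unitary : unitary_on setT Kt Psi)
  (intertwine : forall x, Psi (dilation T Ts DT DTs V Vsa x) = Mz (Psi x))
  (Mzbar_adjoint : forall x y, dot (Mzbar x) y = dot x (Mz y)).

Let J h := Psi (in_H D Ds h).

Lemma model_operatorE h : model_operator Psi Mz (J h) = J (T h).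
Proof.
rewrite /model_operator -intertwine.
rewrite (orthoproj_model_dilation Psi_unitary); congr J.
rewrite -[LHS]/(DTs (Vsa 0) + T h).
by rewrite (linear_on0 _ Vsa_linear)// (linear_on0 _ DTs_linear)// add0r.
Qed.

(** The middle row of the dilation, at a vector of the wandering space of
[l2 Ds]. *)
Lemma C_star_rhsE e : C_star_rhs Psi Mz e = J (DTs (Vsa e)).
Proof.
rewrite /C_star_rhs -intertwine (orthoproj_model_dilation Psi_unitary) /=.
by rewrite (linear_on0 (subspace_setT _) T_linear) addr0.
Qed.

(** Tested against [J k]: moving [Mzbar] to the other side as [Mz] leads to the
last row of the dilation at [k]. *)
Lemma C_rhsE e : C_rhs Psi Mzbar e = J (DT (Va e)).
Proof.
apply: (orthoproj_model Psi_unitary) => k.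
have [_ _ Pdot] := Psi_unitary.
rewrite Mzbar_adjoint -intertwine Pdot//.
rewrite !hsum_dotE /= !dot0l !add0r l2_coef0_adjoint.
rewrite -[l2_coef0 _]/(- V (Ts (Vsa 0)) + V (DT k) + 0).
rewrite (linear_on0 _ Vsa_linear)// (linear_on0 _ Ts_linear)//.
rewrite (linear_on0 _ V_linear)// oppr0 add0r addr0.
by rewrite (adjoint_dot DT_adjoint) (adjoint_dotV V_adjoint).
Qed.

End ModelOperator.

(** * Agreement of the coordinate operators *)

Theorem lemma3p2 (R : realType) (H D Ds : hilbertType R)
    (T Ts DT DTs : H -> H)
    (T_linear : linear_on setT T) (T_contraction : contraction_op T)
    (Ts_adjoint : adjoint_on setT setT T Ts)
    (DT_defect : defect_on setT T Ts DT)
    (DTs_defect : defect_on setT Ts T DTs)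
    (T_cnu : completely_nonunitary T Ts)
    (V : H -> D) (Va : D -> H) (Vs : H -> Ds) (Vsa : Ds -> H)
    (V_coord : coordinate_operator (defect_space setT DT) V Va)
    (Vs_coord : coordinate_operator (defect_space setT DTs) Vs Vsa)
    (theta : R[i] -> D -> Ds)
    (theta_char : characteristic_function T Ts DT DTs Va Vs theta)
    (W : operator_weight (hsum Ds D)) (L : hilbertType R)
    (cls : (R[i] -> hsum Ds D) -> L) (Mz Mzbar : L -> L) (Kt : set L)
    (Psi : dilation_space H D Ds -> L)
    (Psi_trans :
      transcription (dilation T Ts DT DTs V Vsa) W cls Mz Kt Psi)
    (Mzbar_mult : multiplication_operator W cls (fun z => z^*) Mzbar)
    (Ms DM DMs : L -> L) :
  let K := model_space Psi in
  let M := model_operator Psi Mz in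
  let defM := defect_space K DM in
  let defMs := defect_space K DMs in
  let C := C_op Psi DM Mzbar in
  let Cs := C_star_op Psi Mz DMs in
  adjoint_on K K M Ms ->
  defect_on K M Ms DM ->
  defect_on K Ms M DMs ->
  [/\ {in defMs &, injective DMs} /\
        (forall e, (DMs @` defMs) (C_star_rhs Psi Mz e)),
      {in defM &, injective DM} /\
        (forall e, (DM @` defM) (C_rhs Psi Mzbar e)),
      unitary_on setT defMs Cs,
      unitary_on setT defM C &
      exists Phi : L -> H,
        [/\ unitary_on K setT Phi,
            forall x, K x -> T (Phi x) = Phi (M x),
            Phi @` defM `<=` defect_space setT DT /\
            Phi @` defMs `<=` defect_space setT DTs,
            adjoint_on setT defM C (V \o Phi) &
            adjoint_on setT defMs Cs (Vs \o Phi)]].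
Proof.
move=> K M defM defMs C Cs MMs DM_defect DMs_defect.
have [PsiL2 Mz_mult [Kt_closed _] Psi_unitary intertwine] := Psi_trans.
pose J h := Psi (in_H D Ds h).
have J_linear : linear_on setT J := model_embedding_linear Psi_unitary.
have J_dot : forall h k, dot (J h) (J k) = dot h k :=
  model_embedding_dot Psi_unitary.
have J_inj : injective J.
  move=> h k Jhk; apply: dot_extl => u.
  by rewrite -J_dot Jhk J_dot.
pose Phi x := xget 0 [set h | J h = x].
have PhiJ : cancel J Phi.
  move=> h; apply: xget_subset1 => // k l /= kh lh; apply: J_inj.
  by rewrite kh lh.
have Ts_linear := adjoint_linear Ts_adjoint.
have [DT_linear DT_adjoint _ _] := DT_defect.
have [DTs_linear DTs_adjoint _ _] := DTs_defect.
have [V_linear _ _ V_adjoint] := V_coord.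
have [_ _ _ Vs_adjoint] := Vs_coord.
have Vsa_linear := adjoint_linear Vs_adjoint.
have Mzbar_adjoint x y : dot (Mzbar x) y = dot x (Mz y).
  apply: (mult_adjoint PsiL2 Mzbar_mult Mz_mult) => //.
  - exact: circle_multiplier_conj.
  - exact: circle_multiplier_id.
  - by move=> z _; rewrite conjCK.
have MJ h : M (J h) = J (T h).
  exact: (model_operatorE DTs_linear Vsa_linear Psi_unitary intertwine).
have Jrange h : K (J h) by exists h.
have MsJ h : Ms (J h) = J (Ts h).
  have [_ MsK Madj] := MMs.
  have [k _] := MsK _ (Jrange h); rewrite -/(J k) => hk; rewrite -hk; congr J.
  apply: dot_extl => u; rewrite dotC [RHS]dotC; congr (_^*).
  by rewrite -J_dot hk -Madj// MJ J_dot (adjoint_dot Ts_adjoint).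
have Ts_adjointV : adjoint_on setT setT Ts T.
  by split=> // x y _ _; rewrite (adjoint_dotV Ts_adjoint).
have DMJ h : DM (J h) = J (DT h).
  apply: (sqrt_on_transport J_linear J_dot PhiJ _ _ DT_defect DM_defect).
    exact: defect_le Ts_adjoint.
  by move=> k; rewrite MJ MsJ (linear_onB J_linear).
have DMsJ h : DMs (J h) = J (DTs h).
  apply: (sqrt_on_transport J_linear J_dot PhiJ _ _ DTs_defect DMs_defect).
    exact: defect_le Ts_adjointV.
  by move=> k; rewrite MsJ MJ (linear_onB J_linear).
have closed_J := model_space_closed Psi_unitary Kt_closed.
have [C_def C_unitary Phi_def C_adjoint] :=
  coordinate_agreement J_linear J_dot PhiJ closed_J DT_linear DT_adjoint
    V_coord DMJ (C_rhsE Ts_linear V_linear Vsa_linear DT_adjoint V_adjoint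
      Psi_unitary intertwine Mzbar_adjoint).
have [Cs_def Cs_unitary Phi_defs Cs_adjoint] :=
  coordinate_agreement J_linear J_dot PhiJ closed_J DTs_linear DTs_adjoint
    Vs_coord DMsJ (C_star_rhsE T_linear Psi_unitary intertwine).
split=> //; exists Phi; split=> //.
  exact: isometry_inverse_unitary.
by move=> _ [h _ <-]; rewrite -/(J h) MJ !PhiJ.
Qed.
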